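(* Let $\mathbf P\in\mathcal P$, $\mathbf Q\in\mathcal Q$, $\mathbf R\in\mathcal R$ with $\lambda_{\mathbf{PQ}}\ne0$ and $\lambda_{\mathbf{QR}}\neq0$. Then the best linear unbiased estimator of the treatment effect $\mathbf R\mathbf X_f\mathbf X_h\boldsymbol\tau$, using only the projected data $(\mathbf P\vartriangleright\mathbf Q)\mathbf Y$, is $$\frac{1}{\lambda_{\mathbf{PQ}}\lambda_{\mathbf{QR}}}\,\mathbf R\big((\mathbf P\vartriangleright\mathbf Q)\vartriangleright\mathbf R\big)\mathbf Y=\frac{1}{\lambda_{\mathbf{PQ}}\lambda_{\mathbf{QR}}}\,\mathbf{RQP}\mathbf Y .$$ Moreover, the variance matrix of this estimator is $$\frac{\xi_{\mathbf P}+r\lambda_{\mathbf{PQ}}\eta_{\mathbf Q}}{\lambda_{\mathbf{PQ}}\lambda_{\mathbf{QR}}}\,\mathbf R .$$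
   Context: Setting (chain of two randomizations). $\Omega,\Upsilon,\Gamma$ are finite sets, $f\colon\Omega\to\Upsilon$ and $h\colon\Upsilon\to\Gamma$ are surjective maps, and $f$ is equireplicate: every element of $\Upsilon$ has exactly $r$ preimages. $\mathbf X_f$ is the $\Omega\times\Upsilon$ matrix with $(\omega,\upsilon)$-entry $1$ if $f(\omega)=\upsilon$ and $0$ otherwise; $\mathbf X_h$ is the analogous $\Upsilon\times\Gamma$ matrix; $\mathbf D_h=\mathbf X_h'\mathbf X_h$. Primes denote transposes. A transitive permutation group $G$ on a finite set $S$ is stratifiable if the symmetric $0$-$1$ matrices of its symmetrized orbits on $S\times S$ all commute; the orthogonal projectors onto their common eigenspaces (strata) are its stratum projectors. $\mathcal P$ is the set of stratum projectors ($\Omega\times\Omega$ nonzero symmetric, mutually orthogonal idempotents summing to $\mathbf I_\Omega$) of a transitive stratifiable group $G_1$ on $\Omega$. $\mathcal Q$ arises from the stratum projectors $\mathbf Q_\Upsilon$ ($\Upsilon\times\Upsilon$, summing to $\mathbf I_\Upsilon$) of a transitive stratifiable group $G_2$ on $\Upsilon$ (or from a refinement in which some of these are replaced by mutually orthogonal nonzero symmetric sub-idempotents summing to them, all pieces keeping the same coefficient $\eta$): each $\mathbf Q_\Upsilon$ is replaced by the $\Omega\times\Omega$ matrix $\mathbf Q=r^{-1}\mathbf X_f\mathbf Q_\Upsilon\mathbf X_f'$. These are mutually orthogonal symmetric idempotents with sum $\mathbf I_{\mathcal Q}=r^{-1}\mathbf X_f\mathbf X_f'$. $\mathcal R$ arises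 from a set of nonzero symmetric, mutually orthogonal $\Upsilon\times\Upsilon$ idempotents $\mathbf R_\Upsilon$ with sum $\mathbf X_h\mathbf D_h^{-1}\mathbf X_h'$, each replaced by $\mathbf R=r^{-1}\mathbf X_f\mathbf R_\Upsilon\mathbf X_f'$; put $\mathbf I_{\mathcal R}=\sum_{\mathbf R\in\mathcal R}\mathbf R$. Model. $\mathbf Y=\mathbf Z+\mathbf X_f\mathbf W+\mathbf X_f\mathbf X_h\boldsymbol\tau$, where $\boldsymbol\tau\in\mathbb R^\Gamma$ is a fixed (unknown) vector, $\mathbf Z$ (indexed by $\Omega$) and $\mathbf W$ (indexed by $\Upsilon$) are independent random vectors with mean zero, $\operatorname{Cov}(\mathbf Z)=\sum_{\mathbf P}\xi_{\mathbf P}\mathbf P$ and $\operatorname{Cov}(\mathbf W)=\sum\eta_{\mathbf Q}\mathbf Q_\Upsilon$ with $\xi_{\mathbf P},\eta_{\mathbf Q}\ge 0$. Thus $\operatorname E(\mathbf Y)=\mathbf X_f\mathbf X_h\boldsymbol\tau$ and $\operatorname{Cov}(\mathbf Y)=\mathbf V=\sum_{\mathbf P\in\mathcal P}\xi_{\mathbf P}\mathbf P+r\sum_{\mathbf Q\in\mathcal Q}\eta_{\mathbf Q}\mathbf Q$. Structure balance (assumed). $\mathcal Q$ is structure balanced in relation to $\mathcal P$: there are scalars $\lambda_{\mathbf{PQ}}$ with $\mathbf Q\mathbf P\mathbf I_{\mathcal Q}=\lambda_{\mathbf{PQ}}\mathbf Q$ for all $\mathbf P\in\mathcal P$, $\mathbf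 Q\in\mathcal Q$. $\mathcal R$ is structure balanced in relation to $\mathcal Q$: there are scalars $\lambda_{\mathbf{QR}}$ with $\mathbf R\mathbf Q\mathbf I_{\mathcal R}=\lambda_{\mathbf{QR}}\mathbf R$ for all $\mathbf Q\in\mathcal Q$, $\mathbf R\in\mathcal R$. Derived idempotents. If $\lambda_{\mathbf{PQ}}\ne0$, $\mathbf P\vartriangleright\mathbf Q=\lambda_{\mathbf{PQ}}^{-1}\mathbf{PQP}$. If also $\lambda_{\mathbf{QR}}\ne0$, $(\mathbf P\vartriangleright\mathbf Q)\vartriangleright\mathbf R=\lambda_{\mathbf{PQ}}^{-1}\lambda_{\mathbf{QR}}^{-1}\mathbf{PQRQP}$. ''Best linear unbiased estimator using only the projected data $(\mathbf P\vartriangleright\mathbf Q)\mathbf Y$'' means: among the estimators of the form $\mathbf L(\mathbf P\vartriangleright\mathbf Q)\mathbf Y$ ($\mathbf L$ a fixed matrix) whose expectation is $\mathbf R\mathbf X_f\mathbf X_h\boldsymbol\tau$ for every $\boldsymbol\tau\in\mathbb R^\Gamma$, it has the smallest variance matrix in the positive-semidefinite (Loewner) order. *)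

(* Defs.v *)
From HB Require Import structures.
From mathcomp Require Import all_boot all_order all_algebra all_fingroup.
From mathcomp Require Import all_classical all_reals all_analysis.

Set Implicit Arguments.
Unset Strict Implicit.
Unset Printing Implicit Defensive.

Import Order.TTheory GRing.Theory Num.Theory.

Local Open Scope ring_scope.

(* A matrix or column vector indexed by a finite set S has type
   'M_#|S| or 'cV_#|S|; row i stands for the element enum_val i of S. *)

Definition incidence_mx (R : realType) (A B : finType) (f : A -> B) :
    'M[R]_(#|A|, #|B|) :=
  \matrix_(i, j) (f (enum_val i) == enum_val j)%:R.

Section Stratification.
Variables (S : finType) (G : {group {perm S}}).

Definition same_orbit (p q : S * S) : bool :=
  [exists g in G, (g p.1, g p.2) == q].

(* Orbits on S * S are indexed, with repetition, by their elements; the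
   symmetrized orbit of p is the union of its orbit and of the transposed one. *)
Definition sym_orbit_mx (R : realType) (p : S * S) : 'M[R]_#|S| :=
  \matrix_(i, j) (same_orbit p (enum_val i, enum_val j)
                  || same_orbit p (enum_val j, enum_val i))%:R.

Definition stratifiable (R : realType) : Prop :=
  forall p q : S * S, comm_mx (sym_orbit_mx R p) (sym_orbit_mx R q).

(* M is the orthogonal projector onto a nonzero common eigenspace; chi assigns
   to each symmetrized orbit matrix its eigenvalue on that space. Row and
   column eigenspaces agree because these matrices are symmetric. *)
Definition stratum_projector (R : realType) (M : 'M[R]_#|S|) : Prop :=
  [/\ M != 0, M^T = M, M *m M = M &
    exists chi : S * S -> R,
      (M == \bigcap_(p : S * S) eigenspace (sym_orbit_mx R p) (chi p))%MS].

Definition stratum_projectors (R : realType) (I : finType)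
    (P_ : I -> 'M[R]_#|S|) : Prop :=
  injective P_ /\ forall M, stratum_projector M <-> exists i, P_ i = M.

End Stratification.

Section Idempotents.
Variables (R : realType) (n : nat).

Definition orth_idempotents (J : finType) (Q_ : J -> 'M[R]_n) : Prop :=
  [/\ forall j, Q_ j != 0, forall j, (Q_ j)^T = Q_ j &
      forall j k, Q_ j *m Q_ k = if j == k then Q_ j else 0].

(* part j is the idempotent of which Q_ j is a piece; with part the identity
   nothing is refined. *)
Definition refinement (J0 J : finType) (part : J -> J0)
    (Q0_ : J0 -> 'M[R]_n) (Q_ : J -> 'M[R]_n) : Prop :=
  orth_idempotents Q_ /\ forall k, \sum_(j | part j == k) Q_ j = Q0_ k.

Definition structure_balanced (I J : finType) (P_ : I -> 'M[R]_n)
    (Q_ : J -> 'M[R]_n) (IQ : 'M[R]_n) (lam : I -> J -> R) : Prop :=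
  forall i j, Q_ j *m P_ i *m IQ = lam i j *: Q_ j.

Definition psd (A : 'M[R]_n) : Prop :=
  A^T = A /\ forall x : 'cV[R]_n, 0 <= (x^T *m A *m x) 0 0.

End Idempotents.

Definition lift_mx (R : realType) (n m r : nat) (Xf : 'M[R]_(n, m))
    (M : 'M[R]_m) : 'M[R]_n :=
  r%:R^-1 *: (Xf *m M *m Xf^T).

Section RandomVectors.
Context (d : measure_display) (T : measurableType d) (R : realType).
Variable Pr : probability T R.

Definition square_integrable (n : nat) (X : T -> 'cV[R]_n) : Prop :=
  forall i, (fun t => X t i 0) \in Lfun Pr 2%:E.

(* For square-integrable X, all expectations and covariances are finite, so
   that fine loses no information. *)
Definition meanvec (n : nat) (X : T -> 'cV[R]_n) : 'cV[R]_n :=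
  \col_i fine 'E_Pr[fun t => (X t i 0)%R]%E.

Definition covmx (n : nat) (X : T -> 'cV[R]_n) : 'M[R]_n :=
  \matrix_(i, j) fine (covariance Pr (fun t => X t i 0) (fun t => X t j 0)).

(* g_sigma_preimage is the sigma-algebra generated by the coordinates. *)
Definition independent (n m : nat) (X : T -> 'cV[R]_n) (Y : T -> 'cV[R]_m) :
    Prop :=
  forall A B : set T,
    g_sigma_preimage (fun (i : 'I_n) t => X t i 0) A ->
    g_sigma_preimage (fun (i : 'I_m) t => Y t i 0) B ->
    Pr (A `&` B)%classic = (Pr A * Pr B)%E.

(* M *m Y is the best linear unbiased estimator of target tau that uses only
   the projected data K *m Y; the law of Y depends on the parameter tau. *)
Definition is_BLUE (g n k p : nat) (Y : 'cV[R]_g -> T -> 'cV[R]_n)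
    (target : 'cV[R]_g -> 'cV[R]_p) (K : 'M[R]_(k, n)) (M : 'M[R]_(p, n)) :
    Prop :=
  let unbiased (N : 'M[R]_(p, n)) :=
    forall tau, meanvec (fun t => N *m Y tau t) = target tau in
  [/\ exists L : 'M[R]_(p, k), M = L *m K,
      unbiased M &
      forall L : 'M[R]_(p, k), unbiased (L *m K) ->
        forall tau, psd (covmx (fun t => L *m K *m Y tau t)
                         - covmx (fun t => M *m Y tau t))].

End RandomVectors.

(* Main.v *)
Require Import Defs.
From HB Require Import structures.
From mathcomp Require Import all_boot all_order all_algebra all_fingroup.
From mathcomp Require Import all_classical all_reals all_analysis.
From mathcomp Require Import measurable_realfun complex ring.

Set Implicit Arguments.
Unset Strict Implicit.
Unset Printing Implicit Defensive.

Import Order.TTheory GRing.Theory Num.Theory.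

Local Open Scope ring_scope.

(* Write a and b for the efficiency factors of (P, Q) and (Q, R).  Structure
   balance gives Q P Q = a Q, R P Q = a R Q and R Q R = b R, so the estimator is
   M Y with M = (ab)^-1 R Q P.  An estimator N Y is unbiased iff N I_R = R.  If
   V is the covariance matrix of Y, then P V P Q = s P Q with
   s = xi_P + r a eta_Q; hence N V M' = (ab)^-1 s N P Q R = (ab)^-1 s R for every
   unbiased N of the form L (P |> Q), and in particular for N = M.  So N - M is
   uncorrelated with M, and N V N' - M V M' = (N - M) V (N - M)' is positive
   semidefinite.

   I_R is contained in I_Q because the strata of G2 sum to the identity: this is
   the simultaneous diagonalization of commuting real symmetric matrices, with
   real eigenvalues obtained by passing to the complex numbers. *)

(** * Strata of a stratifiable group *)

(** Minimal polynomials are unchanged by conjugation and by field extension. A diagonalization over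
    [L] with diagonal entries from [F] therefore already fixes the minimal polynomial over [F], and
    diagonalizability can be read off from it. *)
Lemma mxminpoly_map_diag (F L : fieldType) (phi : {rmorphism F -> L}) n
    (A : 'M[F]_n.+1) (D : 'rV[F]_n.+1) (U : 'M[L]_n.+1) :
  U \in unitmx ->
  map_mx phi A = invmx U *m diag_mx (map_mx phi D) *m U ->
  mxminpoly A = mxminpoly (diag_mx D).
Proof.
move=> Uunit AE; apply: (map_poly_inj phi).
have UVunit : invmx U \in unitmx by rewrite unitmx_inv.
have DE := map_diag_mx phi D.
rewrite -[LHS](mxminpoly_map phi A) AE -(conjVmx _ Uunit).
rewrite (mxminpoly_uconj _ UVunit) -DE; exact: (mxminpoly_map phi (diag_mx D)).
Qed.

(** Over [F[i]] the matrix is Hermitian, so the spectral theorem applies there. The result descends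
    to [F] through the minimal polynomial. *)
Lemma realsym_diagonalizable (F : rcfType) n (A : 'M[F]_n) :
  A^T = A -> diagonalizable A.
Proof.
case: n A => [|n] A Asym.
  by exists 1%:M; rewrite ?unitmx1//; apply/is_diag_mxP => -[].
pose C : numClosedFieldType := F[i]%C.
pose phi : {rmorphism F -> C} := real_complex F.
pose AC := map_mx phi A.
have ACherm : AC \is hermsymmx.
  apply: realsym_hermsym.
    apply/is_hermitianmxP; rewrite expr0 scale1r map_mx_id//.
    by rewrite map_trmx Asym.
  by apply/mxOverP => i j; rewrite mxE; apply/complex_realP; exists (A i j).
have /orthomx_spectralP ACE := hermitian_normalmx ACherm.
have dreal := hermitian_spectral_diag_real ACherm.
(* Taking real parts loses nothing, since the eigenvalues of a Hermitian matrix are real. *)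
pose D : 'rV[F]_n.+1 := \row_j complex.Re (spectral_diag AC 0 j).
have DE : spectral_diag AC = map_mx phi D.
  apply/rowP => j; rewrite !mxE; apply/esym.
  exact: RRe_real (mxOverP dreal 0 j).
apply/diagonalizableP.
suff -> : mxminpoly A = mxminpoly (diag_mx D).
  by apply/diagonalizableP; exact: diagonalizable_diag.
rewrite DE in ACE.
exact: (@mxminpoly_map_diag F C phi n A D (spectralmx AC) (spectral_unit AC) ACE).
Qed.

Lemma mulmx_trmx_eq0 (F : realDomainType) m n (B : 'M[F]_(m, n)) :
  B *m B^T = 0 -> B = 0.
Proof.
move=> /matrixP BB; apply/matrixP => i j; rewrite mxE.
have /eqP := BB i i; rewrite !mxE.
under eq_bigr do rewrite mxE -expr2.
rewrite psumr_eq0 => [/allP/(_ j)|? _]; last exact: sqr_ge0.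
by rewrite mem_index_enum => /(_ isT)/=; rewrite sqrf_eq0 => /eqP.
Qed.

(** For a basis [C] of the row space, the projector is [C^T G^-1 C] with Gram matrix [G = C C^T].
    [G] is invertible because [v G = 0] makes [v C] a vector of norm zero. *)
Lemma orthogonal_projector_exists (F : realFieldType) m n (B : 'M[F]_(m, n)) :
  exists M : 'M[F]_n, [/\ M^T = M, M *m M = M & (M == B)%MS].
Proof.
move: (row_base_free B) (eq_row_base B); move: (row_base B) => C Cfree BE.
pose G := C *m C^T.
have Gunit : G \in unitmx.
  rewrite -row_free_unit -kermx_eq0; apply/eqP/row_matrixP => i.
  rewrite row0; set v := row i _.
  have vG : v *m G = 0 by apply/sub_kermxP; exact: row_sub.
  apply: (row_free_inj Cfree); rewrite mul0mx.
  by apply: mulmx_trmx_eq0; rewrite trmx_mul mulmxA -(mulmxA v) vG mul0mx.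
have GT : G^T = G by rewrite trmx_mul trmxK.
exists (C^T *m invmx G *m C); split.
- by rewrite trmx_mul trmx_mul trmxK trmx_inv GT mulmxA.
- by rewrite -!mulmxA (mulmxA C) -/G (mulmxA (invmx G) G) mulVmx// mul1mx.
- apply/andP; split; first by rewrite -BE submxMl.
  rewrite -BE; apply/submxP; exists C.
  by rewrite !mulmxA -/G mulmxV// mul1mx.
Qed.

Section Strata.
Variables (R : realType) (S : finType) (G : {group {perm S}}).

Lemma trmx_sym_orbit_mx (p : S * S) :
  (sym_orbit_mx G R p)^T = sym_orbit_mx G R p.
Proof. by apply/matrixP => i j; rewrite !mxE orbC. Qed.

Lemma stratum_projector_eigen (M : 'M[R]_#|S|) chi p :
  (M == \bigcap_(p : S * S) eigenspace (sym_orbit_mx G R p) (chi p))%MS ->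
  M *m sym_orbit_mx G R p = chi p *: M.
Proof.
move=> /eqmxP ME; apply/eigenspaceP; rewrite ME; exact: (bigcapmx_inf p).
Qed.

(** Equal eigenvalue functions give the same space, and a symmetric idempotent is determined by its
    range. Otherwise some orbit matrix separates the two, and eigenspaces of a symmetric matrix for
    distinct eigenvalues are orthogonal. *)
Lemma stratum_projector_orth (M N : 'M[R]_#|S|) :
  stratum_projector G M -> stratum_projector G N -> M != N -> M *m N = 0.
Proof.
move=> [_ MT MM [chi Mchi]] [_ NT NN [chi' Nchi]] MN.
have [/funext chiE|/existsNP[p /eqP chip]] := pselect (chi =1 chi').
  rewrite chiE in Mchi.
  have [/submxP[U UE] /submxP[U' UE']] : (M <= N)%MS /\ (N <= M)%MS.
    by split; rewrite (eqmxP Mchi) (eqmxP Nchi).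
  have MNM : M *m N = M by rewrite UE -mulmxA NN.
  have NMN : N *m M = N by rewrite UE' -mulmxA MM.
  suff E : M = N by rewrite E eqxx in MN.
  by rewrite -[LHS]MT -MNM trmx_mul NT MT NMN.
apply/eqP; have : (chi p - chi' p) *: (M *m N) == 0.
  rewrite scalerBl subr_eq0 scalemxAl -(stratum_projector_eigen p Mchi).
  rewrite scalemxAr -{2}NT -linearZ/= -(stratum_projector_eigen p Nchi).
  by rewrite trmx_mul trmx_sym_orbit_mx NT mulmxA.
by rewrite scaler_eq0 subr_eq0 (negbTE chip).
Qed.

(** The commuting orbit matrices have a common eigenbasis, the rows of [U]. Each row lies in exactly
    one stratum, whose projector fixes it while the others kill it, so the sum acts as the identity
    on a basis. *)
Lemma stratum_projectors_sum (I : finType) (P_ : I -> 'M[R]_#|S|) :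
  stratifiable G R -> stratum_projectors G P_ -> \sum_i P_ i = 1%:M.
Proof.
move=> Gstrat [Pinj PP].
pose As := [seq sym_orbit_mx G R p | p <- enum {: S * S}].
have [|U Uunit /allP Udiag] := (codiagonalizableP As).1.
  split=> [_ _ /mapP[p _ ->] /mapP[q _ ->]|_ /mapP[p _ ->]]; first exact: Gstrat.
  exact/realsym_diagonalizable/trmx_sym_orbit_mx.
suff UE : U *m (\sum_i P_ i) = U *m 1%:M.
  by rewrite -[LHS](mulKmx Uunit) UE mulKmx.
apply/row_matrixP => k; rewrite !row_mul mulmx1; set v := row k U.
(* The eigenvalue of each orbit matrix on row [k] is the [k]-th diagonal entry after the change of
   basis. *)
pose chi p := mxpoly.conjmx U (sym_orbit_mx G R p) k k.
have v0 : v != 0.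
  apply: contra_neq (oner_neq0 R) => v0.
  have /(congr1 (mulmx^~ (invmx U))) := v0; rewrite /v rowE mulmxK// mul0mx.
  by move=> /matrixP/(_ 0 k); rewrite !mxE !eqxx.
have vchi p : v *m sym_orbit_mx G R p = chi p *: v.
  have /Udiag/diagonalizable_forPex[D UD] : sym_orbit_mx G R p \in As.
    by apply: map_f; rewrite mem_enum.
  rewrite /v -row_mul (simmxP Uunit UD) row_mul row_diag_mx -scalemxAl -rowE.
  by rewrite /chi (eqP UD) mxE eqxx mulr1n.
have [M [MT MM ME]] := orthogonal_projector_exists
  (\bigcap_(p : S * S) eigenspace (sym_orbit_mx G R p) (chi p))%MS.
have /submxP[c vE] : (v <= M)%MS.
  rewrite (eqmxP ME); apply/sub_bigcapmxP => p _; exact/eigenspaceP.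
have vM : v *m M = v by rewrite vE -mulmxA MM.
(* The common eigenspace contains [v], which is nonzero, so its projector is a stratum projector and
   belongs to the family. *)
have [i iM] : exists i, P_ i = M.
  apply/PP; split => //; last by exists chi.
  by apply: contra_neq v0 => M0; rewrite -vM M0 mulmx0.
rewrite mulmx_sumr (bigD1 i)//= iM vM big1 ?addr0// => j ji.
rewrite -vM -mulmxA stratum_projector_orth ?mulmx0//.
- by apply/PP; exists i.
- by apply/PP; exists j.
- by rewrite -iM; apply: contra_neq ji => /Pinj.
Qed.

End Strata.

(** * Mean vectors and covariance matrices *)

Section Independence.
Local Open Scope ereal_scope.
Context (d : measure_display) (T : measurableType d) (R : realType).
Variable Pr : probability T R.

(** Independence says that the joint law of [X] and [Y] agrees with the product of the marginal laws
    on rectangles, hence everywhere. Fubini then splits the integral. *)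
Lemma expectation_mul_indep d1 d2 (T1 : measurableType d1)
    (T2 : measurableType d2) (X : {mfun T >-> T1}) (Y : {mfun T >-> T2})
    (g : T1 -> R) (h : T2 -> R) :
  measurable_fun [set: T1] g -> measurable_fun [set: T2] h ->
  g \o X \in Lfun Pr 1 -> h \o Y \in Lfun Pr 1 ->
  ((g \o X) \* (h \o Y))%R \in Lfun Pr 1 ->
  (forall A B, measurable A -> measurable B ->
    Pr (X @^-1` A `&` Y @^-1` B)%classic =
    Pr (X @^-1` A)%classic * Pr (Y @^-1` B)%classic) ->
  'E_Pr[(g \o X) \* (h \o Y)] = 'E_Pr[g \o X] * 'E_Pr[h \o Y].
Proof.
move=> mg mh X1 Y1 XY1 XYindep.
pose m1 := distribution Pr X; pose m2 := distribution Pr Y.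
pose XY t := (X t, Y t).
have mXY : measurable_fun setT XY by exact: measurable_fun_pair.
have mE C : measurable C -> (m1 \x m2) C = pushforward Pr XY C.
  pose MF := @isMeasurableFun.Build _ _ _ _ XY mXY.
  pose XY' : {mfun T >-> (T1 * T2)%type} := HB.pack XY MF.
  apply: (product_measure_unique (m' := pushforward Pr XY')) => A B mA mB.
  exact: XYindep.
pose f z : \bar R := (g z.1 * h z.2)%:E.
have mf : measurable_fun [set: T1 * T2] f.
  by apply/measurable_EFinP; apply: measurable_funM; exact: measurableT_comp.
have fXY : Pr.-integrable setT (f \o XY) by exact/Lfun1_integrable.
have fint : (m1 \x m2).-integrable setT f.
  apply/integrableP; split => //.
  have /integrableP[_] := integrable_pushforward mXY mf fXY measurableT.
  by rewrite (eq_measure_integral (m1 \x m2)%E) // => C mC _; exact/esym/mE.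
have -> : 'E_Pr[(g \o X) \* (h \o Y)] = \int[m1 \x m2]_z f z.
  rewrite unlock -[LHS]/(\int[Pr]_(t in XY @^-1` setT) (f \o XY) t).
  rewrite -integral_pushforward//.
  by apply: eq_measure_integral => C mC _; exact/esym/mE.
rewrite -integral12_prod_meas1//.
have mEg : measurable_fun setT (EFin \o g) by exact/measurable_EFinP.
have mEh : measurable_fun setT (EFin \o h) by exact/measurable_EFinP.
have EX : \int[m1]_x (g x)%:E = 'E_Pr[g \o X].
  by rewrite unlock integral_distribution//; exact/Lfun1_integrable.
have EY : \int[m2]_x (h x)%:E = 'E_Pr[h \o Y].
  by rewrite unlock integral_distribution//; exact/Lfun1_integrable.
have m1int : m1.-integrable setT (EFin \o g).
  by apply: integrable_pushforward => //; exact/Lfun1_integrable.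
have m2int : m2.-integrable setT (EFin \o h).
  by apply: integrable_pushforward => //; exact/Lfun1_integrable.
have inner x : \int[m2]_y f (x, y) = (g x)%:E * 'E_Pr[h \o Y].
  by rewrite -EY -integralZl.
rewrite (eq_integral (fun x => (g x)%:E * (fine 'E_Pr[h \o Y])%:E)).
  by rewrite integralZr// EX fineK// expectation_fin_num.
by move=> x _; rewrite fineK ?expectation_fin_num//; exact: inner.
Qed.

End Independence.

(** * Linearity of means and bilinearity of covariances for square-integrable vectors *)

Section RandomVectors.
Context (d : measure_display) (T : measurableType d) (R : realType).
Variable Pr : probability T R.
Local Notation L2 := (Lfun Pr 2%:E).
Local Notation cov X Y := (fine (covariance Pr X Y)).

Let Pfin : Pr setT \is a fin_num := fin_num_measure Pr _ measurableT.

Lemma Lfun2_add (X Y : T -> R) : X \in L2 -> Y \in L2 -> X \+ Y \in L2.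
Proof. by move=> X2 Y2; rewrite rpredD ?lee1n. Qed.

Lemma Lfun2_scale (a : R) (X : T -> R) : X \in L2 -> (fun t => a * X t) \in L2.
Proof.
move=> X2; rewrite (_ : (fun t => a * X t) = a \o* X); last first.
  by apply/funext => t; rewrite /= mulrC.
by rewrite Lfun_scale ?ler1n.
Qed.

(** The shape [a * X + Y] is the induction step for finite linear combinations. Square integrability
    keeps the covariances finite, so that [fine] is additive on them. *)
Lemma covariance_linearl (a : R) (X Y Z : T -> R) :
  X \in L2 -> Y \in L2 -> Z \in L2 ->
  cov (fun t => a * X t + Y t) Z = a * cov X Z + cov Y Z.
Proof.
move=> X2 Y2 Z2; have aX2 := Lfun2_scale a X2.
have cfin U V : U \in L2 -> V \in L2 -> covariance Pr U V \is a fin_num.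
  by move=> U2 V2; rewrite covariance_fin_num ?Lfun2_mul_Lfun1// Lfun_subset12.
rewrite (covarianceDl aX2 Y2 Z2) fineD ?cfin//; congr (_ + _).
rewrite (_ : (fun t => a * X t) = a \o* X); last first.
  by apply/funext => t; rewrite /= mulrC.
by rewrite covarianceZl ?fineM ?cfin ?Lfun2_mul_Lfun1// Lfun_subset12.
Qed.

Lemma expectation_linear (a : R) (X Y : T -> R) :
  X \in L2 -> Y \in L2 ->
  fine 'E_Pr[(fun t => a * X t + Y t)%R]%E = a * fine 'E_Pr[X]%E + fine 'E_Pr[Y]%E.
Proof.
move=> X2 Y2; have aX2 := Lfun2_scale a X2.
have L12 := Lfun_subset12 Pfin.
rewrite (expectationD (L12 _ aX2) (L12 _ Y2)) fineD ?expectation_fin_num ?L12//.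
congr (_ + _); rewrite (_ : (fun t => a * X t) = a \o* X); last first.
  by apply/funext => t; rewrite /= mulrC.
by rewrite expectationZl ?fineM ?expectation_fin_num ?L12.
Qed.

Lemma Lfun2_cst (c : R) : (fun=> c) \in L2.
Proof. exact: Lfun_cst. Qed.

Section Sum.
Variables (I : Type) (s : seq I) (a : I -> R) (F : I -> T -> R).
Hypothesis F2 : forall i, F i \in L2.

Lemma Lfun2_sum : (fun t => \sum_(i <- s) a i * F i t) \in L2.
Proof.
elim: s => [|i s' IHs].
  by under eq_fun do rewrite big_nil; exact: Lfun2_cst.
under eq_fun do rewrite big_cons; exact: Lfun2_add (Lfun2_scale _ (F2 i)) IHs.
Qed.

End Sum.

Lemma covariance_suml (I : Type) (s : seq I) (a : I -> R) (F : I -> T -> R)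
    (Z : T -> R) : (forall i, F i \in L2) -> Z \in L2 ->
  cov (fun t => \sum_(i <- s) a i * F i t) Z = \sum_(i <- s) a i * cov (F i) Z.
Proof.
move=> F2 Z2; elim: s => [|i s IHs].
  rewrite big_nil; under eq_fun do rewrite big_nil.
  by rewrite -/(cst 0) covariance_cst_l.
rewrite big_cons -IHs -covariance_linearl//; last exact: Lfun2_sum.
by under eq_fun do rewrite big_cons.
Qed.

Lemma expectation_lin_comb (I : Type) (s : seq I) (a : I -> R)
    (F : I -> T -> R) : (forall i, F i \in L2) ->
  fine 'E_Pr[(fun t => \sum_(i <- s) a i * F i t)%R]%E =
  \sum_(i <- s) a i * fine 'E_Pr[F i]%E.
Proof.
move=> F2; elim: s => [|i s IHs].
  rewrite big_nil; under eq_fun do rewrite big_nil.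
  by rewrite -/(cst 0) expectation_cst.
rewrite big_cons -IHs -expectation_linear//; last exact: Lfun2_sum.
by under eq_fun do rewrite big_cons.
Qed.

(** The rectangular form lets each argument be treated separately; the diagonal case is [covmx]. *)
Definition crosscov n m (X : T -> 'cV[R]_n) (Y : T -> 'cV[R]_m) : 'M[R]_(n, m) :=
  \matrix_(i, j) cov (fun t => X t i 0) (fun t => Y t j 0).

Lemma crosscovxx n (X : T -> 'cV[R]_n) : crosscov X X = covmx Pr X.
Proof. by []. Qed.

Lemma trmx_crosscov n m (X : T -> 'cV[R]_n) (Y : T -> 'cV[R]_m) :
  (crosscov X Y)^T = crosscov Y X.
Proof. by apply/matrixP => i j; rewrite !mxE covarianceC. Qed.

Lemma square_integrableD n (X Y : T -> 'cV[R]_n) :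
  square_integrable Pr X -> square_integrable Pr Y ->
  square_integrable Pr (fun t => X t + Y t).
Proof.
by move=> X2 Y2 i; under eq_fun do rewrite mxE; exact: Lfun2_add.
Qed.

Lemma square_integrable_cst n (c : 'cV[R]_n) : square_integrable Pr (fun=> c).
Proof. by move=> i; exact: Lfun2_cst. Qed.

Lemma square_integrableM n m (M : 'M[R]_(m, n)) (X : T -> 'cV[R]_n) :
  square_integrable Pr X -> square_integrable Pr (fun t => M *m X t).
Proof. by move=> X2 i; under eq_fun do rewrite mxE; exact: Lfun2_sum. Qed.

Lemma meanvecM n m (M : 'M[R]_(m, n)) (X : T -> 'cV[R]_n) :
  square_integrable Pr X -> meanvec Pr (fun t => M *m X t) = M *m meanvec Pr X.
Proof.
move=> X2; apply/colP => i; rewrite !mxE; under eq_fun do rewrite mxE.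
by rewrite expectation_lin_comb//; apply: eq_bigr => k _; rewrite mxE.
Qed.

Lemma meanvecD n (X Y : T -> 'cV[R]_n) :
  square_integrable Pr X -> square_integrable Pr Y ->
  meanvec Pr (fun t => X t + Y t) = meanvec Pr X + meanvec Pr Y.
Proof.
move=> X2 Y2; apply/colP => i; rewrite !mxE.
rewrite -[X in _ = X + _]mul1r -expectation_linear//.
by under [in RHS]eq_fun do rewrite mul1r; under eq_fun do rewrite mxE.
Qed.

Lemma meanvec_cst n (c : 'cV[R]_n) : meanvec Pr (fun=> c) = c.
Proof.
by apply/colP => i; rewrite mxE -/(cst (c i 0)) expectation_cst.
Qed.

Lemma crosscovMl n m p (M : 'M[R]_(p, n)) (X : T -> 'cV[R]_n)
    (Y : T -> 'cV[R]_m) :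
  square_integrable Pr X -> square_integrable Pr Y ->
  crosscov (fun t => M *m X t) Y = M *m crosscov X Y.
Proof.
move=> X2 Y2; apply/matrixP => i j; rewrite !mxE; under eq_fun do rewrite mxE.
by rewrite covariance_suml//; apply: eq_bigr => k _; rewrite mxE.
Qed.

Lemma crosscovDl n m (X X' : T -> 'cV[R]_n) (Y : T -> 'cV[R]_m) :
  square_integrable Pr X -> square_integrable Pr X' -> square_integrable Pr Y ->
  crosscov (fun t => X t + X' t) Y = crosscov X Y + crosscov X' Y.
Proof.
move=> X2 X'2 Y2; apply/matrixP => i j; rewrite !mxE.
rewrite -[X in _ = X + _]mul1r -covariance_linearl//.
by under [in RHS]eq_fun do rewrite mul1r; under eq_fun do rewrite mxE.
Qed.

Lemma crosscov_cstl n m (c : 'cV[R]_n) (Y : T -> 'cV[R]_m) :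
  crosscov (fun=> c) Y = 0.
Proof.
by apply/matrixP => i j; rewrite !mxE -/(cst (c i 0)) covariance_cst_l.
Qed.

Lemma covmxM n m (M : 'M[R]_(m, n)) (X : T -> 'cV[R]_n) :
  square_integrable Pr X ->
  covmx Pr (fun t => M *m X t) = M *m covmx Pr X *m M^T.
Proof.
move=> X2; have MX2 := square_integrableM M X2.
rewrite -!crosscovxx crosscovMl// -(trmx_crosscov _ X) crosscovMl//.
by rewrite trmx_mul trmx_crosscov mulmxA.
Qed.

Lemma covmxD n (X Y : T -> 'cV[R]_n) :
  square_integrable Pr X -> square_integrable Pr Y -> crosscov X Y = 0 ->
  covmx Pr (fun t => X t + Y t) = covmx Pr X + covmx Pr Y.
Proof.
move=> X2 Y2 XY0; have XpY2 := square_integrableD X2 Y2.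
rewrite -!crosscovxx crosscovDl// -!(trmx_crosscov (fun t => X t + Y t)).
rewrite !crosscovDl// !linearD/= !trmx_crosscov -(trmx_crosscov X Y) XY0.
by rewrite trmx0 addr0 add0r.
Qed.

(** The quadratic form at [x] is the variance of the scalar variable [x^T X]. *)
Lemma psd_covmx n (X : T -> 'cV[R]_n) :
  square_integrable Pr X -> psd (covmx Pr X).
Proof.
move=> X2; split; first exact: trmx_crosscov.
move=> x; have := covmxM x^T X2; rewrite trmxK => <-.
by rewrite mxE fine_ge0// (variance_ge0 Pr (fun t => (x^T *m X t) 0 0)).
Qed.

Lemma crosscov_independent n m (X : T -> 'cV[R]_n) (Y : T -> 'cV[R]_m) :
  square_integrable Pr X -> square_integrable Pr Y -> independent Pr X Y ->
  crosscov X Y = 0.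
Proof.
move=> X2 Y2 XY; apply/matrixP => i j; rewrite !mxE.
have L12 := Lfun_subset12 Pfin.
have XY1 := Lfun2_mul_Lfun1 (X2 i) (Y2 j).
rewrite (covarianceE (L12 _ (X2 i)) (L12 _ (Y2 j)) XY1).
have MX := set_mem (sub_Lfun_mfun (X2 i)).
have MY := set_mem (sub_Lfun_mfun (Y2 j)).
pose Xi : {mfun T >-> R} :=
  HB.pack (fun t => X t i 0) (@isMeasurableFun.Build _ _ _ _ _ MX).
pose Yj : {mfun T >-> R} :=
  HB.pack (fun t => Y t j 0) (@isMeasurableFun.Build _ _ _ _ _ MY).
rewrite (_ : 'E_Pr[_ * _] = 'E_Pr[Xi] * 'E_Pr[Yj])%E.
  rewrite subee// fin_numM//.
    exact: expectation_fin_num (L12 _ (X2 i)).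
  exact: expectation_fin_num (L12 _ (Y2 j)).
apply: (@expectation_mul_indep _ _ _ Pr _ _ _ _ Xi Yj idfun idfun) => //.
- exact: measurable_id.
- exact: measurable_id.
- exact: L12 _ (X2 i).
- exact: L12 _ (Y2 j).
(* A preimage under one coordinate is among the generators of the sigma-algebra of all
   coordinates. *)
move=> A B mA mB; apply: XY; apply: sub_sigma_algebra.
- by rewrite (bigD1 i)//=; left; exists A => //; rewrite setTI.
- by rewrite (bigD1 j)//=; left; exists B => //; rewrite setTI.
Qed.

End RandomVectors.

(** * Chains of structure-balanced idempotents *)

(** Entry [(u, v)] counts the elements mapped to both [u] and [v]. For [f] this yields [r] times the
    identity; for [h] it yields the invertibility of [Dh]. *)
Lemma incidence_gram (R : realType) (A B : finType) (f : A -> B) :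
  (incidence_mx R f)^T *m incidence_mx R f =
  diag_mx (\row_j #|[pred a | f a == enum_val j]|%:R).
Proof.
apply/matrixP => u v; rewrite !mxE.
have -> : \sum_j (incidence_mx R f)^T u j * incidence_mx R f j v =
    \sum_(a : A) ((f a == enum_val u) && (f a == enum_val v))%:R.
  rewrite (reindex (@enum_val A predT)); last first.
    by apply: onW_bij; exact: enum_val_bij.
  by apply: eq_bigr => k _; rewrite !mxE -natrM mulnb.
have [->|uv] := eqVneq u v.
  rewrite -sum1_card natr_sum [RHS]big_mkcond/= mulr1n.
  by apply: eq_bigr => a _; rewrite andbb inE; case: eqP.
rewrite big1// => a _; case: eqP => //= ->.
by rewrite (inj_eq enum_val_inj) (negbTE uv).
Qed.

(** The factor [r^-1] in the lift cancels [X^T X = r I], so relations between idempotents on Upsilon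
    carry over to Omega. *)
Lemma mul_lift_mx (R : realType) n m r (X : 'M[R]_(n, m)) (A B : 'M[R]_m) :
  r%:R != 0 :> R -> X^T *m X = r%:R%:M ->
  lift_mx r X A *m lift_mx r X B = lift_mx r X (A *m B).
Proof.
move=> r0 XX; rewrite /lift_mx -scalemxAl -scalemxAr !mulmxA.
rewrite -(mulmxA (X *m A) X^T X) XX mul_mx_scalar -!scalemxAl.
by rewrite scalerA mulVf// scale1r.
Qed.

Lemma lift_mx_sum (R : realType) n m r (X : 'M[R]_(n, m)) (I : finType)
    (A : I -> 'M[R]_m) :
  \sum_i lift_mx r X (A i) = lift_mx r X (\sum_i A i).
Proof. by rewrite /lift_mx -scaler_sumr mulmx_sumr mulmx_suml. Qed.

Lemma trmx_lift_mx (R : realType) n m r (X : 'M[R]_(n, m)) (A : 'M[R]_m) :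
  (lift_mx r X A)^T = lift_mx r X A^T.
Proof. by rewrite /lift_mx linearZ/= !trmx_mul trmxK mulmxA. Qed.

(** This is Pythagoras for [N = M + (N - M)]: both cross terms vanish. *)
Lemma congruence_sub (F : comPzRingType) p n (M N : 'M[F]_(p, n))
    (V : 'M[F]_n) :
  V^T = V -> (N - M) *m V *m M^T = 0 ->
  N *m V *m N^T - M *m V *m M^T = (N - M) *m V *m (N - M)^T.
Proof.
move=> VT NM0; have MN0 : M *m V *m (N - M)^T = 0.
  by apply: trmx_inj; rewrite 2!trmx_mul trmxK VT mulmxA NM0 trmx0.
move: NM0; rewrite !mulmxBl => /subr0_eq NM.
by rewrite MN0 subr0 linearB/= mulmxBr NM.
Qed.

Lemma mulmx_cV_inj (F : pzSemiRingType) m n (A B : 'M[F]_(m, n)) :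
  (forall v : 'cV[F]_n, A *m v = B *m v) -> A = B.
Proof.
move=> AB; apply/matrixP => i j; have /colP/(_ i) := AB (delta_mx j 0).
by rewrite -!colE !mxE.
Qed.

(** * Matrix identities for one triple, with [S] and [IS] in the roles of R and I_R *)

Section Chain.
Variables (F : fieldType) (n : nat) (P Q S IQ IS : 'M[F]_n) (a b : F).
Hypotheses (a0 : a != 0) (b0 : b != 0).
Hypotheses (PT : P^T = P) (QT : Q^T = Q) (ST : S^T = S) (IQT : IQ^T = IQ).
Hypotheses (PP : P *m P = P) (SS : S *m S = S).
Hypotheses (QQ : Q *m Q = Q).
Hypotheses (QIQ : Q *m IQ = Q) (SIQ : S *m IQ = S) (ISS : IS *m S = S).
Hypotheses (balPQ : Q *m P *m IQ = a *: Q) (balQS : S *m Q *m IS = b *: S).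

Let IQQ : IQ *m Q = Q.
Proof. by apply: trmx_inj; rewrite trmx_mul QT IQT QIQ. Qed.

Let IQS : IQ *m S = S.
Proof. by apply: trmx_inj; rewrite trmx_mul ST IQT SIQ. Qed.

(** [IQ] fixes [Q] and [S] from the left, so in the balance equation either of them can be
    multiplied in on the right and absorb [IQ]. *)
Let QPQ : Q *m P *m Q = a *: Q.
Proof. by rewrite -{2}IQQ mulmxA balPQ -scalemxAl QQ. Qed.

Let QPS : Q *m P *m S = a *: (Q *m S).
Proof. by rewrite -IQS mulmxA balPQ -scalemxAl IQS. Qed.

Let SPQ : S *m P *m Q = a *: (S *m Q).
Proof.
by apply: trmx_inj; rewrite !trmx_mul mulmxA QT PT ST QPS linearZ/= trmx_mul QT ST.
Qed.

Let SQS : S *m Q *m S = b *: S.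
Proof. by rewrite -{2}ISS mulmxA balQS -scalemxAl SS. Qed.

Let M := (a * b)^-1 *: (S *m Q *m P).

(** Collapsing [S P Q] and then [S Q S] releases the factors [a] and [b], which cancel the
    normalization of the derived idempotent. *)
Lemma chain_estimatorE :
  (a * b)^-1 *: (S *m ((a^-1 * b^-1) *: (P *m Q *m S *m Q *m P))) = M.
Proof.
rewrite -scalemxAr !mulmxA SPQ -!scalemxAl SQS -!scalemxAl !scalerA.
by congr (_ *: _); field; rewrite a0 b0.
Qed.

Lemma chain_estimator_factor :
  M = ((a * b)^-1 *: S) *m (a^-1 *: (P *m Q *m P)).
Proof.
rewrite -scalemxAl -scalemxAr !mulmxA SPQ -!scalemxAl [a^-1 *: _]scalerA.
by rewrite mulVf// scale1r.
Qed.

Let MPQS : M *m P *m Q *m S = S.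
Proof.
rewrite /M -!scalemxAl.
have -> : S *m Q *m P *m P *m Q *m S = S *m (Q *m (P *m P) *m Q) *m S.
  by rewrite !mulmxA.
rewrite PP QPQ -scalemxAr -scalemxAl SQS !scalerA mulVf ?scale1r//.
exact: mulf_neq0.
Qed.

(** Inserting [IQ] in front of [IS] makes both balance equations applicable in turn, releasing [a]
    and then [b]. *)
Lemma chain_estimator_unbiased :
  IQ *m IS = IS -> M *m IS = S.
Proof.
move=> IQIS; rewrite /M -scalemxAl -IQIS.
have -> : S *m Q *m P *m (IQ *m IS) = S *m (Q *m P *m IQ) *m IS.
  by rewrite !mulmxA.
rewrite balPQ -scalemxAr -scalemxAl balQS !scalerA mulVf ?scale1r//.
exact: mulf_neq0.
Qed.

Variables (V : 'M[F]_n) (s : F).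
Hypothesis VPQ : P *m V *m P *m Q = s *: (P *m Q).

Let MT : M^T = (a * b)^-1 *: (P *m Q *m S).
Proof. by rewrite /M linearZ/= !trmx_mul PT QT ST mulmxA. Qed.

(** The covariance of [N Y] with [M Y] depends on [N] only through [N P Q S]; this serves both [M]
    itself and every competing estimator. *)
Let NVMT p (N : 'M[F]_(p, n)) : N *m P = N ->
  N *m V *m M^T = ((a * b)^-1 * s) *: (N *m P *m Q *m S).
Proof.
move=> NP; rewrite MT -scalemxAr -scalerA -{1}NP; congr (_ *: _).
have -> : N *m P *m V *m (P *m Q *m S) = N *m (P *m V *m P *m Q) *m S.
  by rewrite !mulmxA.
by rewrite VPQ -scalemxAr -scalemxAl mulmxA.
Qed.

Lemma chain_estimator_var : M *m V *m M^T = (s / (a * b)) *: S.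
Proof.
rewrite NVMT ?MPQS 1?mulrC//.
by rewrite /M -scalemxAl -(mulmxA _ P P) PP.
Qed.

(** For [N] of this form, [N P Q S] and [N S] both reduce to [L P Q S], so [N P Q S = S], the same
    value as for [M]. The covariances of [N Y] and [M Y] with [M Y] thus agree. *)
Lemma chain_estimator_orth (L : 'M[F]_n) :
  let N := L *m (a^-1 *: (P *m Q *m P)) in
  N *m S = S -> (N - M) *m V *m M^T = 0.
Proof.
move=> N NS.
have NP : N *m P = N by rewrite /N -scalemxAr -scalemxAl -!mulmxA PP.
have MP : M *m P = M by rewrite /M -scalemxAl -(mulmxA _ P P) PP.
have NPQS : N *m P *m Q *m S = S.
  rewrite NP -[RHS]NS /N -!scalemxAr -!scalemxAl; congr (_ *: _).
  have -> : L *m (P *m Q *m P) *m Q *m S = L *m P *m (Q *m P *m Q) *m S.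
    by rewrite !mulmxA.
  have -> : L *m (P *m Q *m P) *m S = L *m P *m (Q *m P *m S).
    by rewrite !mulmxA.
  by rewrite QPQ QPS -!scalemxAr -scalemxAl mulmxA.
by rewrite NVMT ?mulmxBl ?MP ?NP// -[N]NP -[M]MP MPQS NPQS subrr scaler0.
Qed.

End Chain.

(** * Best linear unbiased estimation in the chain of two randomizations *)

Theorem mainTheorem4 (R : realType) (Omega Upsilon Gamma : finType)
    (f : Omega -> Upsilon) (h : Upsilon -> Gamma) (r : nat)
    (f_surj : forall u, exists w, f w = u)
    (h_surj : forall c, exists u, h u = c)
    (f_equireplicate : forall u, #|[pred w | f w == u]| = r)
    (G1 : {group {perm Omega}}) (G2 : {group {perm Upsilon}})
    (G1_trans : [transitive G1, on [set: Omega] | 'P])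
    (G1_strat : stratifiable G1 R)
    (G2_trans : [transitive G2, on [set: Upsilon] | 'P])
    (G2_strat : stratifiable G2 R)
    (I J0 J K : finType)
    (P_ : I -> 'M[R]_#|Omega|)
    (P_strata : stratum_projectors G1 P_)
    (Q0_ : J0 -> 'M[R]_#|Upsilon|)
    (Q0_strata : stratum_projectors G2 Q0_)
    (part : J -> J0) (QU_ : J -> 'M[R]_#|Upsilon|)
    (QU_refines : refinement part Q0_ QU_)
    (RU_ : K -> 'M[R]_#|Upsilon|)
    (RU_orth : orth_idempotents RU_) :
  let Xf : 'M[R]_(#|Omega|, #|Upsilon|) := incidence_mx R f in
  let Xh : 'M[R]_(#|Upsilon|, #|Gamma|) := incidence_mx R h in
  let Dh : 'M[R]_#|Gamma| := Xh^T *m Xh in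
  forall (RU_sum : \sum_k RU_ k = Xh *m invmx Dh *m Xh^T),
  let Q_ (j : J) : 'M[R]_#|Omega| := lift_mx r Xf (QU_ j) in
  let R_ (k : K) : 'M[R]_#|Omega| := lift_mx r Xf (RU_ k) in
  let IQ : 'M[R]_#|Omega| := \sum_j Q_ j in
  let IR : 'M[R]_#|Omega| := \sum_k R_ k in
  forall (lamPQ : I -> J -> R) (lamQR : J -> K -> R)
    (balPQ : structure_balanced P_ Q_ IQ lamPQ)
    (balQR : structure_balanced Q_ R_ IR lamQR)
    (d : measure_display) (T : measurableType d) (Pr : probability T R)
    (Z : T -> 'cV[R]_#|Omega|) (W : T -> 'cV[R]_#|Upsilon|)
    (xi : I -> R) (eta : J -> R)
    (xi_ge0 : forall i, 0 <= xi i) (eta_ge0 : forall j, 0 <= eta j)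
    (eta_part : forall j j', part j = part j' -> eta j = eta j')
    (Z_L2 : square_integrable Pr Z) (W_L2 : square_integrable Pr W)
    (ZW_indep : independent Pr Z W)
    (Z_mean : meanvec Pr Z = 0) (W_mean : meanvec Pr W = 0)
    (Z_cov : covmx Pr Z = \sum_i xi i *: P_ i)
    (W_cov : covmx Pr W = \sum_j eta j *: QU_ j),
  let Y (tau : 'cV[R]_#|Gamma|) (t : T) : 'cV[R]_#|Omega| :=
    Z t + Xf *m W t + Xf *m Xh *m tau in
  forall (i : I) (j : J) (k : K),
  lamPQ i j != 0 -> lamQR j k != 0 ->
  let PQ : 'M[R]_#|Omega| := (lamPQ i j)^-1 *: (P_ i *m Q_ j *m P_ i) in
  let PQR : 'M[R]_#|Omega| :=
    ((lamPQ i j)^-1 * (lamQR j k)^-1) *: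
      (P_ i *m Q_ j *m R_ k *m Q_ j *m P_ i) in
  let est : 'M[R]_#|Omega| := (lamPQ i j * lamQR j k)^-1 *: (R_ k *m PQR) in
  [/\ is_BLUE Pr Y (fun tau => R_ k *m Xf *m Xh *m tau) PQ est,
      forall tau t,
        est *m Y tau t =
        ((lamPQ i j * lamQR j k)^-1 *: (R_ k *m Q_ j *m P_ i)) *m Y tau t &
      forall tau,
        covmx Pr (fun t => est *m Y tau t) =
        ((xi i + r%:R * lamPQ i j * eta j) / (lamPQ i j * lamQR j k)) *: R_ k].
Proof.
move=> Xf Xh Dh RU_sum Q_ R_ IQ IR lamPQ lamQR balPQ balQR d T Pr Z W xi eta.
move=> xi_ge0 eta_ge0 eta_part Z_L2 W_L2 ZW_indep Z_mean W_mean Z_cov W_cov Y.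
move=> i j k a0 b0 PQ PQR est.
have Pstr l : stratum_projector G1 (P_ l) by apply/P_strata.2; exists l.
have [P_inj _] := P_strata.
(* [P_ i] is nonzero, so Omega has a point [w], and the fibre of [f] through [w] has [r]
   elements. *)
have r0 : r%:R != 0 :> R.
  have [P0 _ _ _] := Pstr i.
  have [w _|Omega0] := pickP (@predT Omega); last first.
    by case/eqP: P0; apply/matrixP => l; have := Omega0 (enum_val l).
  rewrite -(f_equireplicate (f w)) pnatr_eq0 -lt0n; apply/card_gt0P.
  by exists w; rewrite inE.
have XfX : Xf^T *m Xf = r%:R%:M.
  rewrite incidence_gram; apply/matrixP => u v.
  by rewrite !mxE f_equireplicate.
have Dh_unit : Dh \in unitmx.
  rewrite /Dh incidence_gram unitmxE det_diag unitfE; apply/prodf_neq0 => c _.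
  rewrite mxE pnatr_eq0 -lt0n; apply/card_gt0P.
  by have [u hu] := h_surj (enum_val c); exists u; rewrite inE hu.
have [[_ QUT QUorth] QUsum] := QU_refines.
have [_ RUT RUorth] := RU_orth.
(* Grouped by [part], the pieces add up to the strata of [G2], which sum to the identity. *)
have QU1 : \sum_j QU_ j = 1%:M.
  rewrite -(stratum_projectors_sum G2_strat Q0_strata).
  rewrite (partition_big part predT)//=; apply: eq_bigr => l _; exact: QUsum.
have liftM A B : lift_mx r Xf A *m lift_mx r Xf B = lift_mx r Xf (A *m B).
  exact: mul_lift_mx.
have IQE : IQ = lift_mx r Xf 1%:M by rewrite /IQ lift_mx_sum QU1.
have IRE : IR = lift_mx r Xf (Xh *m invmx Dh *m Xh^T).
  by rewrite /IR lift_mx_sum RU_sum.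
have Qmul l m : Q_ l *m Q_ m = if l == m then Q_ l else 0.
  rewrite liftM QUorth; case: eqP => // _.
  by rewrite /lift_mx mulmx0 mul0mx scaler0.
have Rmul l m : R_ l *m R_ m = if l == m then R_ l else 0.
  rewrite liftM RUorth; case: eqP => // _.
  by rewrite /lift_mx mulmx0 mul0mx scaler0.
have Pmul l m : P_ l *m P_ m = if l == m then P_ l else 0.
  have [_ _ PP _] := Pstr l; case: eqVneq => [<-//|lm].
  by apply: stratum_projector_orth => //; apply: contra_neq lm => /P_inj.
have PT l : (P_ l)^T = P_ l by have [] := Pstr l.
have QT l : (Q_ l)^T = Q_ l by rewrite trmx_lift_mx QUT.
have RT l : (R_ l)^T = R_ l by rewrite trmx_lift_mx RUT.
have IQT : IQ^T = IQ by rewrite IQE trmx_lift_mx trmx1.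
have QIQ l : Q_ l *m IQ = Q_ l by rewrite IQE liftM mulmx1.
have IQQ l : IQ *m Q_ l = Q_ l by rewrite IQE liftM mul1mx.
have RIQ l : R_ l *m IQ = R_ l by rewrite IQE liftM mulmx1.
have IQIR : IQ *m IR = IR by rewrite IQE IRE liftM mul1mx.
have IRR l : IR *m R_ l = R_ l.
  rewrite /IR mulmx_suml (bigD1 l)//= Rmul eqxx big1 ?addr0// => m ml.
  by rewrite Rmul (negbTE ml).
have RIR l : R_ l *m IR = R_ l.
  rewrite /IR mulmx_sumr (bigD1 l)//= Rmul eqxx big1 ?addr0// => m ml.
  by rewrite Rmul eq_sym (negbTE ml).
(* [IR] is the orthogonal projector onto the column space of [Xf *m Xh], where the expectation of
   [Y] lies. *)
have IRX : IR *m (Xf *m Xh) = Xf *m Xh.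
  rewrite IRE /lift_mx -scalemxAl.
  have -> : Xf *m (Xh *m invmx Dh *m Xh^T) *m Xf^T *m (Xf *m Xh) =
      Xf *m Xh *m invmx Dh *m (Xh^T *m (Xf^T *m Xf) *m Xh).
    by rewrite !mulmxA.
  rewrite XfX mul_mx_scalar -scalemxAl -scalemxAr scalerA mulVf// scale1r.
  by rewrite -/Dh mulmxKV.
have PP := Pmul i i; have QQ := Qmul j j; have RR := Rmul k k.
rewrite !eqxx in PP QQ RR.
pose M := (lamPQ i j * lamQR j k)^-1 *: (R_ k *m Q_ j *m P_ i).
have estE : est = M.
  exact: (chain_estimatorE a0 b0 (PT i) (QT j) (RT k) IQT RR (RIQ k)
    (IRR k) (balPQ i j) (balQR j k)).
pose V := \sum_l xi l *: P_ l + Xf *m (\sum_l eta l *: QU_ l) *m Xf^T.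
have X2 := square_integrableM Xf W_L2.
have ZX0 : crosscov Pr Z (fun t => Xf *m W t) = 0.
  rewrite -trmx_crosscov crosscovMl// -trmx_crosscov.
  by rewrite (crosscov_independent Z_L2 W_L2 ZW_indep) trmx0 mulmx0 trmx0.
have ZX2 := square_integrableD Z_L2 X2.
have Y2 tau : square_integrable Pr (Y tau).
  exact: square_integrableD ZX2 (square_integrable_cst _ _).
have Ycov tau : covmx Pr (Y tau) = V.
  rewrite /Y covmxD//; last by rewrite -trmx_crosscov crosscov_cstl trmx0.
    rewrite -[X in _ + X]crosscovxx crosscov_cstl addr0 covmxD// covmxM//.
    by rewrite Z_cov W_cov.
  exact: square_integrable_cst.
have Ymean N tau : meanvec Pr (fun t => N *m Y tau t) = N *m (Xf *m Xh *m tau).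
  rewrite (meanvecM N (Y2 tau)); congr (_ *m _).
  rewrite /Y meanvecD//; last exact: square_integrable_cst.
  by rewrite meanvec_cst meanvecD// meanvecM// Z_mean W_mean mulmx0 !add0r.
pose s := xi i + r%:R * lamPQ i j * eta j.
(* The [Z] part contributes [xi i]. In the [W] part balance leaves only [l = j], contributing
   [r * eta j * lamPQ i j], where [r] compensates the [r^-1] of the lift. *)
have VPQ : P_ i *m V *m P_ i *m Q_ j = s *: (P_ i *m Q_ j).
  have QPQ l : Q_ l *m P_ i *m Q_ j = if l == j then lamPQ i j *: Q_ j else 0.
    rewrite -(IQQ j) mulmxA balPQ -scalemxAl Qmul.
    by case: eqP => [->|_]; rewrite ?IQQ// scaler0.
  rewrite /V; have -> : Xf *m (\sum_l eta l *: QU_ l) *m Xf^T =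
      \sum_l (r%:R * eta l) *: Q_ l.
    rewrite mulmx_sumr mulmx_suml; apply: eq_bigr => l _.
    by rewrite -scalemxAr -scalemxAl /Q_ /lift_mx scalerA mulrAC mulfV// mul1r.
  have PV : P_ i *m (\sum_l xi l *: P_ l) = xi i *: P_ i.
    rewrite mulmx_sumr (bigD1 i)//= -scalemxAr PP big1 ?addr0// => l li.
    by rewrite -scalemxAr Pmul eq_sym (negbTE li) scaler0.
  have VQ : (\sum_l (r%:R * eta l) *: Q_ l) *m P_ i *m Q_ j =
      (r%:R * eta j * lamPQ i j) *: Q_ j.
    rewrite !mulmx_suml (bigD1 j)//= -2!scalemxAl QPQ eqxx scalerA big1 ?addr0//.
    by move=> l lj; rewrite -2!scalemxAl QPQ (negbTE lj) scaler0.
  rewrite mulmxDr !mulmxDl PV -2!scalemxAl PP; set U := \sum_l _.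
  have -> : P_ i *m U *m P_ i *m Q_ j = P_ i *m (U *m P_ i *m Q_ j).
    by rewrite !mulmxA.
  rewrite VQ.
  rewrite -(scalemxAr _ (P_ i) (Q_ j)) -scalerDl; congr (_ *: _).
  by rewrite /s; ring.
have estV := chain_estimator_var a0 b0 (PT i) (QT j) (RT k) IQT PP RR QQ (QIQ j)
  (IRR k) (balPQ i j) (balQR j k) VPQ.
(* Since [tau] is arbitrary, unbiasedness means that [N] and [R_ k] agree on [Xf *m Xh]. Multiplying
   on the right by [r^-1 Dh^-1 Xh^T Xf^T] turns this into [N IR = R_ k IR = R_ k]. *)
have unbiasedP N : (forall tau,
    meanvec Pr (fun t => N *m Y tau t) = R_ k *m Xf *m Xh *m tau) <->
    N *m IR = R_ k.
  split=> [Nunb|NIR tau]; last first.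
    by rewrite Ymean -IRX !mulmxA NIR.
  have NX : N *m (Xf *m Xh) = R_ k *m (Xf *m Xh).
    by apply: mulmx_cV_inj => v; rewrite -!mulmxA; move: (Nunb v);
      rewrite Ymean -!mulmxA.
  rewrite -[RHS]RIR IRE /lift_mx -!scalemxAr !mulmxA; congr (_ *: (_ *m _)).
  by rewrite -(mulmxA N) NX !mulmxA.
split.
- split.
  + exists ((lamPQ i j * lamQR j k)^-1 *: R_ k).
    rewrite estE.
    exact: (chain_estimator_factor _ a0 (PT i) (QT j) (RT k) IQT (RIQ k)
      (balPQ i j)).
  + apply/unbiasedP; rewrite estE.
    exact: (chain_estimator_unbiased a0 b0 (balPQ i j) (balQR j k) IQIR).
  + move=> L /unbiasedP Lunb tau.
    rewrite !covmxM// Ycov estE.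
    have VT : V^T = V by rewrite -(Ycov tau); have [] := psd_covmx (Y2 tau).
    rewrite congruence_sub//; last first.
      apply: (chain_estimator_orth a0 b0 (PT i) (QT j) (RT k) IQT PP RR QQ
        (QIQ j) (RIQ k) (IRR k) (balPQ i j) (balQR j k) VPQ).
      (* Unbiasedness gives [N R = N IR R = R R = R]. *)
      by rewrite -{1}IRR mulmxA Lunb RR.
    (* The remaining congruence of [V] is the covariance matrix of the difference of the two
       estimators. *)
    rewrite -(Ycov tau) -covmxM//; exact/psd_covmx/square_integrableM.
- by move=> tau t; rewrite estE.
- by move=> tau; rewrite covmxM// Ycov estE; exact: estV.
Qed.
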